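(* Let $n\ge 3$ and let $\Gamma$ be a connected simple graph of order $n$ with no bridges. Then $SO(\Gamma)\ge \sqrt{8}\,n$, with equality if and only if $\Gamma\cong C_n$.
   Context: The Sombor index of a graph $\Gamma$ is $SO(\Gamma)=\sum_{uv\in E(\Gamma)}\sqrt{\deg_\Gamma(u)^2+\deg_\Gamma(v)^2}$. A bridge is an edge whose deletion disconnects the graph. $C_n$ is the cycle on $n$ vertices. *)

(* Defs.v *)
From mathcomp Require Import all_boot all_order all_algebra.
From mathcomp Require Import reals.

Set Implicit Arguments.
Unset Strict Implicit.
Unset Printing Implicit Defensive.

Import Order.TTheory GRing.Theory Num.Theory.

Record sgraph := SGraph {
  vertex :> finType;
  adj : rel vertex;
  adj_sym : symmetric adj;
  adj_irrefl : irreflexive adj }.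

Definition edges (G : sgraph) : {set {set G}} :=
  [set [set p.1; p.2] | p : G * G & adj p.1 p.2].

Definition deg (G : sgraph) (v : G) : nat := #|[set u | adj v u]|.

Definition connected (G : sgraph) : Prop :=
  (0 < #|G|)%N /\ forall u v : G, connect (@adj G) u v.

Section DeleteEdge.
Variables (G : sgraph) (e : {set G}).

Definition delete_adj : rel G := [rel u v | adj u v && ([set u; v] != e)].

Lemma delete_adj_sym : symmetric delete_adj.
Proof. by move=> u v; rewrite /delete_adj /= adj_sym setUC. Qed.

Lemma delete_adj_irrefl : irreflexive delete_adj.
Proof. by move=> u; rewrite /delete_adj /= adj_irrefl. Qed.

Definition delete_edge : sgraph := SGraph delete_adj_sym delete_adj_irrefl.

End DeleteEdge.

Definition bridge (G : sgraph) (e : {set G}) : Prop :=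
  e \in edges G /\ ~ connected (delete_edge e).

Definition isomorphic (G H : sgraph) : Prop :=
  exists f : G -> H, bijective f /\ forall u v : G, adj (f u) (f v) = adj u v.

Section Cycle.
Variable n : nat.

(* [ordS] is the successor modulo [n]; this is the cycle C_n for n >= 3.  The
   conjunct [i != j] only matters for n = 1, where [ordS] has a fixed point. *)
Definition cycle_adj : rel 'I_n :=
  [rel i j | (i != j) && ((j == ordS i) || (i == ordS j))].

Lemma cycle_adj_sym : symmetric cycle_adj.
Proof. by move=> i j; rewrite /cycle_adj /= eq_sym orbC. Qed.

Lemma cycle_adj_irrefl : irreflexive cycle_adj.
Proof. by move=> i; rewrite /cycle_adj /= eqxx. Qed.

Definition cycle_graph : sgraph := SGraph cycle_adj_sym cycle_adj_irrefl.

End Cycle.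

Local Open Scope ring_scope.

(* An edge [e] is a two-element set {u, v}, so the inner sum is
   deg(u)^2 + deg(v)^2. *)
Definition sombor (R : realType) (G : sgraph) : R :=
  \sum_(e in edges G) Num.sqrt (\sum_(v in e) (deg v)%:R ^+ 2).

(* Main.v *)
(** A vertex of degree one would be the endpoint of a bridge, so every degree is
    at least 2; hence every edge contributes at least [sqrt 8], and by the
    handshake lemma there are at least [n] edges.  Equality forces the graph to
    be 2-regular.  As no edge is a bridge, there is a simple cycle; in a
    2-regular graph it is closed under adjacency, hence by connectedness it
    visits every vertex. *)

Require Import Defs.
From mathcomp Require Import all_boot all_order all_algebra.
From mathcomp Require Import reals.
From mathcomp Require Import zify.

Set Implicit Arguments.
Unset Strict Implicit.
Unset Printing Implicit Defensive.

Import Order.TTheory GRing.Theory Num.Theory.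

Section Cycles.
Variable T : eqType.
Implicit Types (c : seq T) (x : T).

(** Reads [next] on positions as the successor modulo the length, which is the form [ordS] takes on
    ordinals. *)
Lemma index_next c x : uniq c -> x \in c ->
  index (next c x) c = (index x c).+1 %% size c.
Proof.
case: c => // y p c_uniq x_c; rewrite next_nth x_c.
have := x_c; rewrite -index_mem ltnS leq_eqVlt => /predU1P[->|lt_xp].
  (* For the last entry the lookup runs past the end of [p]; its default [y] is the head of [c], so
     the index wraps to 0. *)
  by rewrite nth_default // index_head modnn.
by rewrite -[nth y p _]/(nth y (y :: p) _.+1) index_uniq // modn_small.
Qed.

(** If both neighbours agreed, [next] applied twice would fix [x]; but with [c] rotated to start at
    [x], it leads to the third entry. *)
Lemma next_neq_prev c x : uniq c -> 2 < size c -> x \in c ->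
  next c x != prev c x.
Proof.
move=> c_uniq c_gt2 x_c; apply/eqP => eq_np.
have : next c (next c x) = x by rewrite eq_np next_prev.
case: (rot_to x_c) => i s def_s.
rewrite -!(next_rot i c_uniq) def_s.
have : uniq (x :: s) by rewrite -def_s rot_uniq.
have : 2 < size (x :: s) by rewrite -def_s size_rot.
case: s {def_s} => [|y [|z s]] //= _ /andP[].
rewrite !inE !negb_or => /and3P[xy xz _] _.
by rewrite eqxx eq_sym (negPf xy) eqxx => zx; rewrite zx eqxx in xz.
Qed.

End Cycles.

Section Degrees.
Variable G : sgraph.
Implicit Types (u v : G) (e : {set G}).

Lemma edgesP e :
  reflect (exists u v, adj u v /\ e = [set u; v]) (e \in edges G).
Proof.
apply: (iffP imsetP) => [[[u v]]|[u [v [uv ->]]]].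
  by rewrite inE => uv ->; exists u, v.
by exists (u, v); rewrite ?inE.
Qed.

Lemma adj_neq u v : adj u v -> u != v.
Proof. by apply: contraTneq => ->; rewrite adj_irrefl. Qed.

(** Double counting of incident vertex-edge pairs: an edge has two endpoints, and [u] mapped to
    [[set v; u]] matches the neighbours of [v] with the edges at [v]. *)
Lemma handshake : \sum_(v : G) deg v = (#|edges G| * 2)%N.
Proof.
have -> : (#|edges G| * 2 = \sum_(e in edges G) \sum_(v | v \in e) 1)%N.
  rewrite -sum_nat_const; apply: eq_bigr => _ /edgesP[u [v [uv ->]]].
  by rewrite sum1_card cards2 adj_neq.
rewrite (exchange_big_dep predT) //=; apply: eq_bigr => v _.
rewrite sum1_card /deg.
have inj_v : {in [set u | adj v u] &, injective (fun u => [set v; u])}.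
  move=> u w; rewrite !inE => vu vw /setP/(_ u); rewrite !inE eqxx orbT.
  by rewrite eq_sym (negPf (adj_neq vu)) => /esym/eqP.
rewrite -(card_in_imset inj_v); apply: eq_card => e; rewrite [RHS]inE.
apply/imsetP/andP => [[u]|[/edgesP[a [b [ab ->]]]]].
  rewrite inE => vu ->; rewrite !inE eqxx; split=> //.
  by apply/edgesP; exists v, u.
rewrite !inE => /orP[/eqP->|/eqP->]; first by exists b; rewrite ?inE.
by exists a; rewrite ?inE 1?adj_sym // setUC.
Qed.

Lemma bridgeless_connect u v : (forall e, ~ bridge e) -> adj u v ->
  connect (delete_adj [set u; v]) u v.
Proof.
move=> nobr uv; apply/negPn/negP => disc.
apply: (nobr [set u; v]); split; first by apply/edgesP; exists u, v.
by case=> _ /(_ u v); apply/negP.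
Qed.

(** Connectedness gives a neighbour [u]; a path from [v] to [u] avoiding the edge between them
    leaves [v] through a second neighbour. *)
Lemma bridgeless_deg v : connected G -> (forall e, ~ bridge e) -> 1 < #|G| ->
  2 <= deg v.
Proof.
move=> G_conn nobr G_gt1.
have [u vu] : exists u, adj v u.
  have : 0 < #|[set~ v]| by rewrite cardsC1; lia.
  case/card_gt0P=> w; rewrite !inE => wv.
  have /connectP[[|u p] /= vp ew] := G_conn.2 v w.
    by rewrite ew eqxx in wv.
  by case/andP: vp => vu _; exists u.
have /connectP[p vp eu] := bridgeless_connect nobr vu.
case: p => [|w p] in vp eu; first by move: (adj_neq vu); rewrite eu eqxx.
case/andP: vp => /andP[vw vw_vu] _.
rewrite /deg -(_ : #|[set u; w]| = 2).
  by apply/subset_leq_card/subsetP => x; rewrite !inE => /orP[]/eqP->.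
by rewrite cards2 (_ : u != w) //; apply: contraNneq vw_vu => ->.
Qed.

(** Two distinct neighbours already fill a neighbourhood of size 2. *)
Lemma deg2_adj u v w x : deg u = 2 -> adj u v -> adj u w -> v != w ->
  adj u x = (x == v) || (x == w).
Proof.
move=> du uv uw vw.
suff /eqP/setP/(_ x) : [set v; w] == [set y | adj u y] by rewrite !inE.
rewrite eqEcard -/(deg u) du cards2 vw andbT.
by apply/subsetP => y; rewrite !inE => /orP[]/eqP->.
Qed.

(** A simple path joining the ends of an edge without using it is closed up by that edge. *)
Lemma bridgeless_cycle : connected G -> (forall e, ~ bridge e) -> 1 < #|G| ->
  exists c, [/\ cycle (@adj G) c, uniq c & 2 < size c].
Proof.
move=> G_conn nobr G_gt1; case/card_gt0P: (G_conn.1) => u _.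
have := bridgeless_deg u G_conn nobr G_gt1.
move/ltnW/card_gt0P=> [v]; rewrite inE => uv.
have /connectP[p0 up0] := bridgeless_connect nobr uv.
case/shortenP: up0 => p up p_uniq _ ev.
exists (u :: p); split=> //.
  rewrite /= rcons_path -ev adj_sym uv andbT.
  by apply: sub_path up => x y /andP[].
(* An empty path would give [u = v], and a single step would be the deleted edge. *)
case: p up ev {p_uniq} => [|w [|]] //= up ev.
  by move: (adj_neq uv); rewrite ev eqxx.
by rewrite -ev /delete_adj /= eqxx andbF in up.
Qed.

End Degrees.

Lemma two_regular_cycle (G : sgraph) (c : seq G) : connected G ->
    (forall v : G, deg v = 2) ->
    cycle (@adj G) c -> uniq c -> 2 < size c ->
  isomorphic G (cycle_graph #|G|).
Proof.
move=> G_conn deg2 c_cyc c_uniq c_gt2.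
(* On [c] the successor and predecessor are two distinct neighbours, hence all of them. *)
have adjE x y : x \in c -> adj x y = (y == next c x) || (y == prev c x).
  move=> x_c; apply: deg2_adj; rewrite ?deg2 ?next_neq_prev //.
    exact: next_cycle.
  by rewrite adj_sym; apply: prev_cycle.
have c_all x : x \in c.
  have [y0 y0_c] : exists y, y \in c.
    case: c c_gt2 {c_cyc c_uniq adjE} => // y s _.
    by exists y; rewrite mem_head.
  have cl : closed (@adj G) [in c].
    apply: intro_closed; first exact/sym_connect_sym/adj_sym.
    move=> a b ab a_c; move: ab; rewrite adjE // => /orP[]/eqP-> /=.
      by rewrite mem_next.
    by rewrite mem_prev.
  by have /= <- := closed_connect cl (G_conn.2 y0 x).
have c_size : size c = #|G|.
  by rewrite -(card_uniqP c_uniq); apply: eq_card => x; rewrite c_all.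
have idx_lt x : index x c < #|G| by rewrite -c_size index_mem.
(* The isomorphism sends a vertex to its position along [c]. *)
pose f (x : G) : cycle_graph #|G| := Ordinal (idx_lt x).
have f_inj : injective f.
  by move=> x y /(congr1 val) /= /index_inj->.
have f_next x : f (next c x) = ordS (f x).
  by apply: val_inj; rewrite /= index_next // c_size.
exists f; split.
  by apply: inj_card_bij => //; rewrite card_ord.
move=> u v; rewrite /= /cycle_adj /= -!f_next !(inj_eq f_inj).
(* Applying [prev] turns [u == next c v] into [prev c u == v], so that [adjE] can be folded back. *)
rewrite adjE // -[u == next c v](can_eq (next_prev c_uniq)) prev_next //.
rewrite [prev c u == v]eq_sym -adjE //.
by case uv: (adj u v); rewrite ?andbF ?andbT // adj_neq.
Qed.

Lemma cycle_graph_deg n (i : cycle_graph n) : 2 < n -> deg i = 2.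
Proof.
move=> n_gt2; rewrite /deg.
have neq_i (j : 'I_n) : ordS j != j.
  apply/eqP => /(congr1 val) /=; have := ltn_ord j.
  rewrite leq_eqVlt => /predU1P[e|lt_jn]; first by rewrite e modnn; lia.
  by rewrite modn_small //; lia.
have neq_sp : ordS i != ord_pred i.
  (* Equality would make [i] its own second successor; the case splits treat wrap-around at the
     first and at the second step. *)
  apply/eqP => /(congr1 (@ordS n)); rewrite ord_predK => /(congr1 val) /=.
  have := ltn_ord i.
  rewrite leq_eqVlt => /predU1P[e|lt_in].
    by rewrite e modnn modn_small //; lia.
  rewrite (modn_small lt_in); move: lt_in.
  rewrite leq_eqVlt => /predU1P[e|lt_in]; first by rewrite e modnn; lia.
  by rewrite modn_small //; lia.
rewrite -[RHS](_ : #|[set ordS i; ord_pred i]| = 2);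
  last by rewrite cards2 neq_sp.
have pred_eq (j : 'I_n) : (j == ord_pred i) = (i == ordS j).
  by rewrite -(can_eq (@ordSK n)) ord_predK eq_sym.
apply: eq_card => j; rewrite !inE pred_eq /= /cycle_adj /=.
case: (j =P ordS i) => [->|_] /=; first by rewrite eq_sym neq_i.
by case: (i =P ordS j) => [->|_]; rewrite ?andbF // neq_i.
Qed.

Lemma isomorphic_deg (G H : sgraph) (f : G -> H) v : bijective f ->
  (forall u v, adj (f u) (f v) = adj u v) -> deg (f v) = deg v.
Proof.
move=> [g fK gK] f_adj; rewrite /deg -(card_imset _ (can_inj fK)).
apply: eq_card => y; rewrite inE; apply/idP/imsetP => [fvy|[u]].
  by exists (g y); rewrite ?gK // inE -f_adj gK.
by rewrite inE => vu ->; rewrite f_adj.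
Qed.

Local Open Scope ring_scope.

Section Sombor.
Variables (R : realType) (G : sgraph).

Lemma sombor_ge : (forall v : G, 2 <= deg v)%N ->
  Num.sqrt 8 * #|edges G|%:R <= sombor R G.
Proof.
move=> deg_ge2; rewrite mulr_natr -sumr_const.
apply: ler_sum => _ /edgesP[u [v [uv ->]]].
rewrite big_setU1 ?inE ?adj_neq // big_set1 /=.
apply: ler_wsqrtr; rewrite -!natrX -natrD ler_nat.
by move: (deg_ge2 u) (deg_ge2 v); nia.
Qed.

Lemma sombor_2regular : (forall v : G, deg v = 2) ->
  sombor R G = Num.sqrt 8 * #|edges G|%:R.
Proof.
move=> deg2; rewrite mulr_natr -sumr_const.
apply: eq_bigr => _ /edgesP[u [v [uv ->]]].
by rewrite big_setU1 ?inE ?adj_neq // big_set1 /= !deg2 -!natrX -natrD.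
Qed.

Lemma edges_2regular : (forall v : G, deg v = 2) -> #|edges G| = #|G|.
Proof.
move=> deg2; apply/eqP; rewrite -(@eqn_pmul2r 2) // -handshake.
by rewrite (eq_bigr (fun=> 2%N)) // sum_nat_const.
Qed.

Lemma card_edges_ge : (forall v : G, 2 <= deg v)%N -> (#|G| <= #|edges G|)%N.
Proof.
move=> deg_ge2; rewrite -(@leq_pmul2r 2) // -handshake -sum_nat_const.
exact: leq_sum.
Qed.

(** By [handshake] the degrees sum to at most twice the order; the vertices other than [v] already
    take at least 2 each, which leaves at most 2 for [v]. *)
Lemma card_edges_le_2regular : (forall v : G, 2 <= deg v)%N ->
  (#|edges G| <= #|G|)%N -> forall v : G, deg v = 2.
Proof.
move=> deg_ge2 le_EG v; apply/eqP; rewrite eqn_leq deg_ge2 andbT.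
move: le_EG; rewrite -(@leq_pmul2r 2) // -handshake -sum_nat_const.
rewrite (bigD1 v) //= [X in (_ <= X)%N](bigD1 v) //= => le_sum.
have : (\sum_(i | i != v) 2 <= \sum_(i : G | i != v) deg i)%N by exact: leq_sum.
by lia.
Qed.

End Sombor.

Theorem theorem4p1 (R : realType) (n : nat) (G : sgraph)
    (n_ge3 : (3 <= n)%N) (order_G : #|G| = n)
    (G_conn : connected G) (G_bridgeless : forall e : {set G}, ~ bridge e) :
  (Num.sqrt 8 * n%:R <= sombor R G) /\
  (sombor R G = Num.sqrt 8 * n%:R <-> isomorphic G (cycle_graph n)).
Proof.
have G_gt1 : (1 < #|G|)%N by rewrite order_G ltnW.
have deg_ge2 v := bridgeless_deg v G_conn G_bridgeless G_gt1.
have sqrt8_gt0 : 0 < Num.sqrt 8 :> R by rewrite sqrtr_gt0.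
have SO_ge := sombor_ge R deg_ge2.
split.
  apply: le_trans SO_ge.
  by rewrite ler_pM2l // ler_nat -order_G card_edges_ge.
split=> [SO_eq|[f [f_bij f_adj]]].
  have deg2 : forall v : G, deg v = 2.
    apply: card_edges_le_2regular => //.
    (* Cancelling the positive factor [Num.sqrt 8] leaves at most [n] edges. *)
    by move: SO_ge; rewrite SO_eq ler_pM2l // ler_nat order_G.
  have [c [c_cyc c_uniq c_gt2]] := bridgeless_cycle G_conn G_bridgeless G_gt1.
  by rewrite -order_G; apply: two_regular_cycle c_cyc c_uniq c_gt2.
have deg2 (v : G) : deg v = 2.
  by rewrite -(isomorphic_deg v f_bij f_adj) cycle_graph_deg.
by rewrite sombor_2regular // edges_2regular // order_G.
Qed.
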